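(* Let $n,m$ be coprime integers with $2<n<m$, let $\lambda\in\mathcal{Z}(n,m)$ and $\Phi(\lambda)=(p,q)$. For any $f=y^n-x^m+x^{p}y^{q}+\sum_{(i,j)\in \mathcal I_{\lambda}}a_{i,j}x^iy^j\in \mathcal{L}(n,m,\lambda)$, the Newton polygon of the generic polar curve $P(f)$ is equal to the Newton polygon of the set $$E_{\lambda}\ \cup\ \left\{(i,j-1),(i-1,j):\ (i,j)\in T_{\lambda}\cap\operatorname{supp}(f) \right\}.$$ In particular, the Newton polygon of $P(f)$ is equal to the Newton polygon of the generic polar of $y^n-x^m+x^{p}y^{q}+\sum_{(i,j)\in T_{\lambda}\cap\operatorname{supp}(f)}a_{i,j}x^iy^j$ and, consequently, if $T_{\lambda}=\emptyset$ then the Newton polygon of $P(f)$ is the Newton polygon of $E_{\lambda}$.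
   Context: $\mathbb N=\{0,1,2,\dots\}$. $\langle n,m\rangle=\mathbb N n+\mathbb N m$. $\mathcal{Z}(n,m):=\{\lambda\in\mathbb{N}:\lambda>m \text{ and } \lambda+n\notin\langle n,m\rangle\}$. Every $\lambda\in\mathcal Z(n,m)$ is uniquely of the form $\lambda=\alpha m-\beta n$ with integers $2\le\alpha\le n-1$ and $2\le\beta<\frac{(\alpha-1)m}{n}$, and one sets $\Phi(\lambda):=(m-\beta,\alpha-1)=:(p,q)$; thus $np+mq=(n-1)m+\lambda>nm$. $\mathcal I_\lambda:=\{(i,j)\in\mathbb N^2: in+jm>pn+qm,\ 0\le i\le m-2,\ 0\le j\le n-2\}$. $K(n,m)$ is the set of plane branches (irreducible germs $f(x,y)=0$, $f\in\mathbb C\{x,y\}$) with characteristic exponents $(n,m)$. Any such branch is analytically equivalent to one with parametrization $(t^n,t^m)$ (then its Zariski invariant is $\infty$) or $(t^n,t^m+t^{\lambda}+\sum_{i>\lambda}a_it^i)$ with $\lambda>m$, $\lambda+n\notin\langle n,m\rangle$ (then its Zariski invariant is $\lambda\in\mathcal Z(n,m)$). $\mathcal L(n,m,\lambda)$ is the set of branches in $K(n,m)$ with Zariski invariant $\lambda$; up to analytic change of coordinates each, for $\lambda\in\mathcal Z(n,m)$, has an equation $f=y^n-x^m+x^py^q+\sum_{(i,j)\in\mathcal I_\lambda}a_{i,j}x^iy^j$ with $a_{i,j}\in\mathbb C$, and writing $f\in\mathcal L(n,m,\lambda)$ means that $f$ has this form. The polar curves of $f$ are $af_x+bf_y=0$,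 $(a:b)\in\mathbb P^1(\mathbb C)$; the generic polar $P(f)$ is this curve for $(a:b)$ in a suitable nonempty Zariski open subset of $\mathbb P^1(\mathbb C)$ (on which the topological type is constant); assertions about $P(f)$ are for generic $(a:b)$. For $f=\sum a_{i,j}x^iy^j$, $\operatorname{supp}(f)=\{(i,j):a_{i,j}\ne0\}$. For $S\subseteq\mathbb N^2$, the Newton diagram of $S$ is the convex hull of $S+(\mathbb R_{\ge0})^2$, and the Newton polygon of $S$ is the compact polygonal boundary of the Newton diagram. The Newton polygon of a power series (or of the curve it defines) is that of its support. $E_\lambda:=\{(0,n-1),(m-1,0),(p,q-1)\}$. $T_\lambda:=\left\{(\alpha_1,\alpha_2)\in\mathbb N^2: p<\alpha_1<m-1,\ 0<\alpha_2<q,\ \frac{q-1}{m-1-p}\le\frac{q-\alpha_2}{\alpha_1-p}<\frac nm\right\}$. *)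

(* Defs.v *)
From mathcomp Require Import all_boot all_order all_algebra.
From mathcomp Require Import complex mpoly.
From mathcomp Require Import boolp classical_sets reals topology normedtype convex.

Set Implicit Arguments.
Unset Strict Implicit.
Unset Printing Implicit Defensive.

Import Order.TTheory GRing.Theory Num.Theory.
Import numFieldNormedType.Exports.

Local Open Scope classical_set_scope.
Local Open Scope ring_scope.
Local Open Scope complex_scope.

(* Throughout, the field of complex numbers is R[i] with R : realType, and
   polynomials in x, y are elements of {mpoly R[i][2]} with x = 'X_0 and
   y = 'X_1. *)

Section Combinatorics.
Local Open Scope nat_scope.

Definition semigroup2 (n m : nat) : set nat :=
  [set s | exists i j, s = i * n + j * m].

Definition zariski_exponents (n m : nat) : set nat :=
  [set lam | m < lam /\ ~ semigroup2 n m (lam + n)].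

(* The graph of Phi on zariski_exponents n m: lam = alpha m - beta n and
   beta < (alpha - 1) m / n are written without subtraction or division. For
   2 < n < m coprime, alpha and beta exist and are unique, and beta < m, so the
   subtractions in (m - beta, alpha - 1) do not truncate. *)
Definition is_Phi (n m lam : nat) (pq : nat * nat) : Prop :=
  exists alpha beta : nat,
    [/\ lam + beta * n = alpha * m,
        2 <= alpha <= n - 1,
        2 <= beta /\ beta * n < (alpha - 1) * m &
        pq = (m - beta, alpha - 1)].

Definition Ilam (n m p q i j : nat) : bool :=
  [&& p * n + q * m < i * n + j * m, i <= m - 2 & j <= n - 2].

Definition Tlam (n m p q i j : nat) : bool :=
  [&& p < i < m - 1, 0 < j < q,
      ((q%:R - 1) / (m%:R - 1 - p%:R) <= (q%:R - j%:R) / (i%:R - p%:R) :> rat)%R &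
      ((q%:R - j%:R) / (i%:R - p%:R) < n%:R / m%:R :> rat)%R].

Definition Elam (n m p q : nat) : set (nat * nat) :=
  [set (0, n - 1); (m - 1, 0); (p, q - 1)].

End Combinatorics.

Section NewtonPolygon.
Variable R : realType.

Definition plane := (R^o * R^o)%type.

Definition newton_diagram (S : set (nat * nat)) : set plane :=
  smallest (@convex_set R plane)
    [set P | exists2 s, S s & s.1%:R <= P.1 /\ s.2%:R <= P.2].

Definition exposed_face (D : set plane) (w : plane) : set plane :=
  [set P | D P /\
     forall Q, D Q -> w.1 * P.1 + w.2 * P.2 <= w.1 * Q.1 + w.2 * Q.2].

(* The compact polygonal boundary: the union of the compact faces (vertices
   and bounded edges) of the Newton diagram. *)
Definition newton_polygon (S : set (nat * nat)) : set plane :=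
  [set P | exists w : plane,
     [/\ w <> (0, 0), compact (exposed_face (newton_diagram S) w) &
         exposed_face (newton_diagram S) w P]].

End NewtonPolygon.

Section Polars.
Variable R : realType.
Implicit Types f : {mpoly R[i][2]}.

Definition supp f : set (nat * nat) :=
  [set ij | f@_(U_(0%R) *+ ij.1 + U_(1%R) *+ ij.2)%MM != 0].

(* y^n - x^m + x^p y^q + \sum_((i, j) in D) a_(i,j) x^i y^j, for sets D of
   exponents (i, j) with i < m and j < n. *)
Definition branch_eq (n m p q : nat) (D : set (nat * nat))
    (a : nat -> nat -> R[i]) : {mpoly R[i][2]} :=
  'X_1 ^+ n - 'X_0 ^+ m + 'X_0 ^+ p * 'X_1 ^+ q
  + \sum_(i < m) \sum_(j < n | `[< D (i : nat, j : nat) >])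
      a i j *: ('X_0 ^+ i * 'X_1 ^+ j).

Definition polar f (ab : R[i] * R[i]) : {mpoly R[i][2]} :=
  ab.1 *: f^`M(0) + ab.2 *: f^`M(1).

(* A Zariski open subset of P^1(C), given by the homogeneous coordinates
   (a, b) <> (0, 0) of its points: the complement of the common zeros of a
   family of homogeneous polynomials. *)
Definition zariski_open_P1 (U : set (R[i] * R[i])) : Prop :=
  exists H : set {mpoly R[i][2]},
    (forall h, H h -> exists d : nat, h \is d.-homog) /\
    U = [set ab | ab <> (0, 0) /\
          exists2 h, H h & h.@[fun k => if k == 0 then ab.1 else ab.2] != 0].

(* N is the Newton polygon of the generic polar P(f). *)
Definition generic_polar_polygon f (N : set (plane R)) : Prop :=
  exists U : set (R[i] * R[i]),
    [/\ zariski_open_P1 U, U !=set0 &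
        forall ab, U ab -> newton_polygon (supp (polar f ab)) = N].

End Polars.

(* Main.v *)
Require Import Defs.
From mathcomp Require Import all_boot all_order all_algebra.
From mathcomp Require Import complex mpoly.
From mathcomp Require Import boolp classical_sets reals topology normedtype convex.
From mathcomp Require Import interval_inference.
From mathcomp Require Import zify ring.

Set Implicit Arguments.
Unset Strict Implicit.
Unset Printing Implicit Defensive.

Import Order.TTheory GRing.Theory Num.Theory.

Local Open Scope classical_set_scope.
Local Open Scope ring_scope.
Local Open Scope complex_scope.

(** Differentiating [f] moves each exponent [(i, j)] of [f] to [(i - 1, j)] and
    [(i, j - 1)]. For generic [(a : b)] the two families of terms of
    [a f_x + b f_y] cannot cancel ([generic_supp]: only finitely many points of
    the projective line, the zeros of the linear forms given by the
    coefficients, are excluded), so the support of the generic polar is the set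
    of all shifted exponents of [f] ([generic_polar_polygon_derived]). It remains
    to compare the Newton polygon of that set with the one in the theorem; the
    polygon depends only on the Newton diagram, and a diagram contains another
    one as soon as it contains its generators ([newton_polygon_eq]).

    The exponents [(0, n)], [(m, 0)], [(p, q)] of [f] give the three points of
    [E]. Every other exponent [(i, j)] lies strictly above the line of slope
    [- n / m] through [(p, q)], and [(p, q)] lies strictly above the line from
    [(0, n)] to [(m, 0)]. Let the left and the right edge be the segments from
    [(p, q - 1)] to [(0, n - 1)] and to [(m - 1, 0)].
    - If [i <= p], the left edge has slope of absolute value
      [(n - q) / p < n / m < 1], so that both shifts of [(i, j)], and the shift
      [(p - 1, q)], lie above it.
    - If [p < i] and [q <= j], both shifts dominate [(p, q - 1)].
    - If [p < i] and [j < q], then [0 < j] and the slope from [(p, q)] to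
      [(i, j)] is less than [n / m] in absolute value. Either it is at least the
      slope of the right edge, which is exactly [(i, j)] being in [T], or it is
      smaller, and then both shifts lie above the right edge.
    These are the cases of [derived_in_diagram]. The truncated equation satisfies
    the same hypotheses and has the same exponents in [T], so it has the same
    polygon. *)

(** * Newton diagrams are convex and upward closed *)

Section Diagram.
Variable R : realType.
Implicit Types (S : set (nat * nat)) (P : plane R).

Local Notation diagram := (@newton_diagram R).

Lemma newton_diagram_gen S s P :
  S s -> s.1%:R <= P.1 -> s.2%:R <= P.2 -> diagram S P.
Proof. by move=> Ss le1 le2; apply: sub_gen_smallest; exists s. Qed.

Lemma newton_diagram_conv S : @convex_set R (plane R) (diagram S).
Proof.
move=> P Q t; rewrite !inE => SP SQ A [cA sA].
have := cA P Q t; rewrite !inE; apply; [exact: SP|exact: SQ].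
Qed.

(** Translating a convex set keeps it convex, so it is enough to test the
    generators of the diagram. *)
Lemma newton_diagram_up S P Q :
  diagram S P -> P.1 <= Q.1 -> P.2 <= Q.2 -> diagram S Q.
Proof.
move=> SP le1 le2; pose v : plane R := Q - P.
have -> : Q = P + v by rewrite /v addrC subrK.
pose A : set (plane R) := [set P | diagram S (P + v)].
apply: (smallest_sub (X := A) _ _ SP).
  move=> X Y t; rewrite !inE /A /= => AX AY.
  have := @newton_diagram_conv S (X + v) (Y + v) t.
  rewrite !inE => /(_ AX AY); congr (diagram S _).
  by congr pair; rewrite /conv /= /GRing.scale /= /unstable.onem; ring.
move=> X [s Ss [sX1 sX2]]; apply: (newton_diagram_gen Ss); rewrite /=.
  by apply: (le_trans sX1); rewrite lerDl subr_ge0.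
by apply: (le_trans sX2); rewrite lerDl subr_ge0.
Qed.

Lemma newton_diagram_sub S1 S2 :
  (forall s, S1 s -> diagram S2 (s.1%:R, s.2%:R)) -> diagram S1 `<=` diagram S2.
Proof.
move=> S12; apply: smallest_sub; first exact: newton_diagram_conv.
by move=> P [s /S12 S2s [le1 le2]]; apply: newton_diagram_up S2s _ _.
Qed.

Lemma newton_polygon_eq S1 S2 :
  (forall s, S1 s -> diagram S2 (s.1%:R, s.2%:R)) ->
  (forall s, S2 s -> diagram S1 (s.1%:R, s.2%:R)) ->
  @newton_polygon R S1 = newton_polygon S2.
Proof.
move=> S12 S21; rewrite /newton_polygon; suff -> : diagram S1 = diagram S2 by [].
by apply/seteqP; split; apply: newton_diagram_sub.
Qed.

Lemma newton_diagram_ge S (x y u v : nat) :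
  S (x, y) -> (x <= u)%N -> (y <= v)%N -> diagram S (u%:R, v%:R).
Proof. by move=> Sxy xu yv; apply: (newton_diagram_gen Sxy); rewrite ler_nat. Qed.

(** The convex combination of the two endpoints with abscissa [u] has weight
    [(x2 - u) / (x2 - x1)] at the first one; the hypothesis is its comparison
    with [v], cleared of denominators. *)
Lemma newton_diagram_chord S (x1 y1 x2 y2 u v : nat) :
  S (x1, y1) -> S (x2, y2) -> (x1 < x2)%N -> (x1 <= u <= x2)%N ->
  (y1 * (x2 - u) + y2 * (u - x1) <= v * (x2 - x1))%N ->
  diagram S (u%:R, v%:R).
Proof.
move=> S1 S2 x12 /andP[x1u ux2].
rewrite -(ler_nat R) natrD !natrM !natrB ?(ltnW x12)// => above.
have d_gt0 : 0 < x2%:R - x1%:R :> R by rewrite subr_gt0 ltr_nat.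
have d_neq0 : x2%:R - x1%:R != 0 :> R by rewrite gt_eqF.
pose t : R := (x2%:R - u%:R) / (x2%:R - x1%:R).
have t0 : 0 <= t by rewrite divr_ge0 ?(ltW d_gt0)// subr_ge0 ler_nat.
have t1 : t <= 1 by rewrite ler_pdivrMr// mul1r lerB// ler_nat.
have D1 : diagram S (x1%:R, y1%:R) by exact: newton_diagram_ge S1 _ _.
have D2 : diagram S (x2%:R, y2%:R) by exact: newton_diagram_ge S2 _ _.
have := @newton_diagram_conv S (x1%:R, y1%:R) (x2%:R, y2%:R) (Itv01 t0 t1).
rewrite !inE => /(_ D1 D2) /newton_diagram_up; apply.
- rewrite /conv /= /GRing.scale /= /unstable.onem /t le_eqVlt; apply/orP; left; apply/eqP.
  by field.
- rewrite /conv /= /GRing.scale /= /unstable.onem /t.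
  rewrite -(ler_pM2r d_gt0); apply: le_trans above; rewrite le_eqVlt.
  by apply/orP; left; apply/eqP; field.
Qed.

End Diagram.

(** * The Newton polygon of the shifted exponents *)

Section Combinatorics.
Local Open Scope nat_scope.

(** The union of the supports of the two partial derivatives of a polynomial
    with support [F], in characteristic zero. *)
Definition derived_exponents (F : set (nat * nat)) : set (nat * nat) :=
  [set uv | F (uv.1.+1, uv.2) \/ F (uv.1, uv.2.+1)].

Lemma TlamE (n m p q i j : nat) : p + 1 < m -> 0 < q ->
  Tlam n m p q i j =
  [&& p < i < m - 1, 0 < j < q, (q - 1) * (i - p) <= (q - j) * (m - 1 - p)
    & (q - j) * m < n * (i - p)].
Proof.
move=> pm q0; rewrite /Tlam.
case pi: (p < i < m - 1) => //=; case jq: (0 < j < q) => //=.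
have e1 : (q%:R - 1 = (q - 1)%:R :> rat)%R by rewrite natrB.
have e2 : (m%:R - 1 - p%:R = (m - 1 - p)%:R :> rat)%R by rewrite !natrB//; lia.
have e3 : (q%:R - j%:R = (q - j)%:R :> rat)%R by rewrite natrB//; lia.
have e4 : (i%:R - p%:R = (i - p)%:R :> rat)%R by rewrite natrB//; lia.
rewrite e1 e2 e3 e4.
have h2 : (0 < (m - 1 - p)%:R :> rat)%R by rewrite ltr0n; lia.
have h4 : (0 < (i - p)%:R :> rat)%R by rewrite ltr0n; lia.
have h5 : (0 < m%:R :> rat)%R by rewrite ltr0n; lia.
congr (_ && _).
  by rewrite ler_pdivrMr// mulrAC ler_pdivlMr// -!natrM ler_nat.
by rewrite ltr_pdivrMr// mulrAC ltr_pdivlMr// -!natrM ltr_nat.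
Qed.

(** Comparison of slopes: [r / p <= n / m] and [n / m <= l / k] give
    [r / p <= l / k]. *)
Lemma slope_leq (n m p r k l : nat) :
  0 < m -> r * m <= p * n -> k * n <= l * m -> r * k <= l * p.
Proof.
move=> m_gt0 rm kn; rewrite -(leq_pmul2r m_gt0).
by have := leq_mul rm (leqnn k); have := leq_mul (leqnn p) kn; lia.
Qed.

(** What the polygon computation uses of [(p, q) = Phi(lambda)]: an exponent
    inside the rectangle and above the segment from [(0, n)] to [(m, 0)]. *)
Record interior_exponent (n m p q : nat) : Prop := InteriorExponent {
  interior_n_lt_m : n < m;
  interior_p_gt0 : 0 < p;
  interior_p_lt : p + 1 < m;
  interior_q_gt0 : 0 < q;
  interior_q_lt : q + 1 < n;
  interior_above : n * m < p * n + q * m }.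

Section NewtonPolygonOfDerivatives.
Variables (n m p q : nat).
Hypothesis pqP : interior_exponent n m p q.

Let n_lt_m : n < m. Proof. by case: pqP. Qed.
Let p_gt0 : 0 < p. Proof. by case: pqP. Qed.
Let p_lt : p + 1 < m. Proof. by case: pqP. Qed.
Let q_gt0 : 0 < q. Proof. by case: pqP. Qed.
Let q_lt : q + 1 < n. Proof. by case: pqP. Qed.
Let above : n * m < p * n + q * m. Proof. by case: pqP. Qed.

(** The left edge is less steep than the diagonal: [(n - q) / p < n / m < 1]. *)
Lemma left_slope_lt1 : n - q < p.
Proof.
have h : (n - q) * m < p * n.
  by have : 0 < p * n; [rewrite muln_gt0 p_gt0; lia | rewrite mulnBl; lia].
rewrite ltnNge; apply/negP => le.
by have := leq_mul le (ltnW n_lt_m); lia.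
Qed.

(** An exponent left of [(p, q)] and above the line of slope [- n / m] through it
    is also above the less steep line from [(p, q)] to [(0, n)]. *)
Lemma left_excess i j : i <= p -> p * n + q * m <= i * n + j * m ->
  q <= j /\ (n - q) * (p - i) <= (j - q) * p.
Proof.
move=> ip le.
have qj : q <= j.
  rewrite leqNgt; apply/negP => jq.
  have := leq_mul ip (leqnn n); have : j * m < q * m by rewrite ltn_mul2r jq; lia.
  by lia.
split=> //; apply: (@slope_leq n m); first by lia.
  by rewrite mulnBl; lia.
by rewrite !mulnBl; lia.
Qed.

(** The shift by [(0, -1)] moves the line from [(p, q)] to [(0, n)] onto the left
    edge. In the proof the differences are named, to remove the truncated
    subtractions. *)
Lemma above_left_edge_y i j : i <= p -> p * n + q * m <= i * n + j * m ->
  (n - 1) * (p - i) + (q - 1) * (i - 0) <= (j - 1) * (p - 0).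
Proof.
move=> ip /(left_excess ip)[qj]; rewrite !subn0.
have [k ->] : exists k, p = i + k by exists (p - i); lia.
have [l ->] : exists l, j = q + l by exists (j - q); lia.
have [r ->] : exists r, n = q + r by exists (n - q); lia.
have [s ->] : exists s, q = s + 1 by exists (q - 1); lia.
have -> : s + 1 + r - (s + 1) = r by lia.
have -> : i + k - i = k by lia.
have -> : s + 1 + l - (s + 1) = l by lia.
have -> : s + 1 + r - 1 = s + r by lia.
have -> : s + 1 + l - 1 = s + l by lia.
rewrite addnK; lia.
Qed.

(** The shift by [(-1, 0)] differs from the one by [(0, -1)] by [(-1, 1)], which
    points upwards from the left edge because the slope is less than one. *)
Lemma above_left_edge_x i j : 0 < i <= p -> p * n + q * m <= i * n + j * m ->
  (n - 1) * (p - (i - 1)) + (q - 1) * (i - 1 - 0) <= j * (p - 0).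
Proof.
move=> /andP[i0 ip] /(left_excess ip)[qj]; rewrite !subn0.
have := left_slope_lt1.
have [h eh] : exists h, i = h + 1 by exists (i - 1); lia.
have [k ek] : exists k, p = i + k by exists (p - i); lia.
have [l ->] : exists l, j = q + l by exists (j - q); lia.
have [r er] : exists r, n = q + r by exists (n - q); lia.
have [s es] : exists s, q = s + 1 by exists (q - 1); lia.
rewrite er es ek eh.
have -> : s + 1 + r - (s + 1) = r by lia.
have -> : h + 1 + k - (h + 1) = k by lia.
have -> : h + 1 + k - (h + 1 - 1) = k + 1 by lia.
have -> : s + 1 + l - (s + 1) = l by lia.
have -> : s + 1 + r - 1 = s + r by lia.
rewrite !addnK; lia.
Qed.

(** The last hypothesis says that [(i, j)] is strictly above the line through
    [(p, q)] parallel to the right edge; the shift moves that line onto the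
    edge. *)
Lemma above_right_edge_y i j : p < i < m - 1 -> 0 < j < q ->
  (q - j) * (m - 1 - p) < (q - 1) * (i - p) ->
  (q - 1) * (m - 1 - i) + 0 * (i - p) <= (j - 1) * (m - 1 - p).
Proof.
move=> /andP[pi im] /andP[j0 jq].
have [d ed] : exists d, i = p + d by exists (i - p); lia.
have [c ec] : exists c, m - 1 = p + d + c by exists (m - 1 - i); lia.
have [l el] : exists l, j = l + 1 by exists (j - 1); lia.
have [e ee] : exists e, q = l + 1 + e by exists (q - j); lia.
have -> : q - j = e by lia.
have -> : m - 1 - p = d + c by lia.
have -> : q - 1 = l + e by lia.
have -> : i - p = d by lia.
have -> : m - 1 - i = c by lia.
have -> : j - 1 = l by lia.
lia.
Qed.

(** The right edge may be steeper than one, and then the shift by [(-1, 0)] is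
    not covered by the one by [(0, -1)]; but in that case [n < m] already makes
    the slope from [(p, q)] to [(i, j)] less than one, so [(i - 1, j)] is not below
    the line of slope [-1] through [(p, q)], hence above the right edge. *)
Lemma above_right_edge_x i j : p < i < m - 1 -> 0 < j < q ->
  (q - j) * m < n * (i - p) ->
  (q - j) * (m - 1 - p) < (q - 1) * (i - p) ->
  (q - 1) * (m - 1 - (i - 1)) + 0 * (i - 1 - p) <= j * (m - 1 - p).
Proof.
move=> /andP[pi im] /andP[j0 jq] h1.
have ltd : (q - j) < i - p.
  rewrite ltnNge; apply/negP => le.
  by have := leq_mul (ltnW n_lt_m) le; lia.
have [d ed] : exists d, i = p + d + 1 by exists (i - p - 1); lia.
have [c ec] : exists c, m - 1 = p + d + 1 + c by exists (m - 1 - i); lia.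
have [l el] : exists l, j = l + 1 by exists (j - 1); lia.
have [e ee] : exists e, q = l + 1 + e + 1 by exists (q - j - 1); lia.
have : e <= d by lia.
have -> : q - j = e + 1 by lia.
have -> : m - 1 - p = d + c + 1 by lia.
have -> : q - 1 = l + e + 1 by lia.
have -> : i - p = d + 1 by lia.
have -> : m - 1 - (i - 1) = c + 1 by lia.
have -> : i - 1 - p = d by lia.
rewrite el => ed' lt.
(* The right edge has slope at most one exactly when q - 1 <= m - 1 - p. *)
have [|gt] := leqP (l + e + 1) (d + c + 1); first by lia.
have := leq_mul (ltnW gt) ed'; lia.
Qed.

Lemma Tlam_Ilam i j : Tlam n m p q i j -> Ilam n m p q i j.
Proof.
rewrite TlamE // /Ilam => /and4P[/andP[? ?] /andP[? ?] _ ?].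
apply/and3P; split; [|lia|lia].
have : (q - j) * m + j * m = q * m by rewrite -mulnDl subnK; lia.
have : n * (i - p) + n * p = n * i by rewrite -mulnDr subnK; lia.
lia.
Qed.

Section Cover.
Variables (R : realType) (G : set (nat * nat)) (i j : nat).
Local Notation diagram := (@newton_diagram R G).
Hypotheses (EG : Elam n m p q `<=` G) (i_le : i <= m - 2)
  (weakly_above : p * n + q * m <= i * n + j * m)
  (strictly_above : p < i -> p * n + q * m < i * n + j * m)
  (TG : Tlam n m p q i j -> G (i - 1, j) /\ G (i, j - 1)).

(** Being above the line of slope [- n / m] through [(p, q)] is assumed strictly
    only to the right of [p], so that the exponent [(p, q)] itself is included. *)
Lemma derived_in_diagram :
  (0 < i -> diagram ((i - 1)%:R, j%:R)%R) /\ (0 < j -> diagram (i%:R, (j - 1)%:R)%R).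
Proof.
have G1 : G (0, n - 1) by apply: EG; left; left.
have G2 : G (m - 1, 0) by apply: EG; left; right.
have G3 : G (p, q - 1) by apply: EG; right.
have [ip|pi] := leqP i p.
  split=> [i0|_].
    by apply: (newton_diagram_chord G1 G3) => //; [lia|apply: above_left_edge_x; rewrite ?i0].
  by apply: (newton_diagram_chord G1 G3) => //; exact: above_left_edge_y.
have lt_ij := strictly_above pi.
have [qj|jq] := leqP q j.
  by split=> _; apply: (newton_diagram_ge G3); lia.
(* On the x-axis, being above the diagonal would force i > m. *)
have j0 : 0 < j.
  rewrite lt0n; apply/eqP => j0; rewrite j0 in lt_ij.
  by have : i * n <= m * n; [apply: leq_mul; lia | lia].
have im : p < i < m - 1 by lia.
have jq' : 0 < j < q by lia.
have flat : (q - j) * m < n * (i - p).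
  have := leq_mul (ltnW pi) (leqnn n); have := leq_mul (ltnW jq) (leqnn m).
  by rewrite mulnBl mulnBr; lia.
case T : (Tlam n m p q i j).
  have [T1 T2] := TG T.
  by split=> _; [apply: (newton_diagram_ge T1)|apply: (newton_diagram_ge T2)].
move: T; rewrite TlamE // im jq' flat andbT /= => /negbT; rewrite -ltnNge => steep.
by split=> _; apply: (newton_diagram_chord G3 G2);
  (lia || exact: above_right_edge_x || exact: above_right_edge_y).
Qed.

End Cover.

Lemma newton_polygon_derived (R : realType) (F : set (nat * nat)) :
  F (0, n) -> F (m, 0) -> F (p, q) ->
  (forall i j, F (i, j) ->
    [\/ (i, j) = (0, n), (i, j) = (m, 0), (i, j) = (p, q) | Ilam n m p q i j]) ->
  @newton_polygon R (derived_exponents F) =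
  newton_polygon (Elam n m p q `|`
    [set uv | exists i j, [/\ Tlam n m p q i j, F (i, j) &
                 uv = (i, j - 1) \/ uv = (i - 1, j)]]).
Proof.
move=> F1 F2 F3 sF; set G := _ `|` _.
have EG : Elam n m p q `<=` G by move=> ? ?; left.
have cover i j : F (i, j) -> (i, j) = (p, q) \/ Ilam n m p q i j ->
  (0 < i -> newton_diagram (R := R) G ((i - 1)%:R, j%:R)%R) /\
  (0 < j -> newton_diagram (R := R) G (i%:R, (j - 1)%:R)%R).
  move=> Fij Iij; apply: derived_in_diagram => //.
  - by case: Iij => [[-> _]|/and3P[]//]; lia.
  - by case: Iij => [[-> ->]|/and3P[/ltnW]].
  - by case: Iij => [[-> _]|/and3P[]//]; rewrite ltnn.
  - by move=> T; split; right; exists i, j; split=> //; [right|left].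
apply: newton_polygon_eq => [[u v] /= []|[u v] /= [[[|]|]|[i [j [T Fij uvE]]]]].
- move=> Fuv; case: (sF _ _ Fuv) => [[//]|[uE vE]|uvE|I].
  + by apply: (newton_diagram_ge (x := m - 1) (y := 0)); [apply: EG; left; right|lia|lia].
  + by have [+ _] := cover _ _ Fuv (or_introl uvE); rewrite subn1 => /(_ isT).
  + by have [+ _] := cover _ _ Fuv (or_intror I); rewrite subn1 => /(_ isT).
- move=> Fuv; case: (sF _ _ Fuv) => [[uE vE]|[//]|uvE|I].
  + by apply: (newton_diagram_ge (x := 0) (y := n - 1)); [apply: EG; left; left|lia|lia].
  + by have [_ +] := cover _ _ Fuv (or_introl uvE); rewrite subn1 => /(_ isT).
  + by have [_ +] := cover _ _ Fuv (or_intror I); rewrite subn1 => /(_ isT).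
- move=> [-> ->]; apply: newton_diagram_ge (leqnn _) (leqnn _).
  by right; rewrite /= subn1 prednK //; lia.
- move=> [-> ->]; apply: newton_diagram_ge (leqnn _) (leqnn _).
  by left; rewrite /= subn1 prednK //; lia.
- move=> [-> ->]; apply: newton_diagram_ge (leqnn _) (leqnn _).
  by right; rewrite /= subn1 prednK //; lia.
- move: T; rewrite TlamE // => /and4P[/andP[pi _] /andP[j0 _] _ _].
  case: uvE => -[-> ->]; apply: newton_diagram_ge (leqnn _) (leqnn _).
    by right; rewrite /= subn1 prednK.
  by left; rewrite /= subn1 prednK //; lia.
Qed.

End NewtonPolygonOfDerivatives.
End Combinatorics.

(** * The support of the generic polar *)

Section Support.
Variable R : realType.
Implicit Types (f g h : {mpoly R[i][2]}) (ab : R[i] * R[i]).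

Definition mnm2 (i j : nat) : 'X_{1..2} := (U_(0%R) *+ i + U_(1%R) *+ j)%MM.

Lemma mnm2_0 i j : mnm2 i j 0%R = i.
Proof. by rewrite mnmDE !mulmnE !mnm1E /= mul1n mul0n addn0. Qed.

Lemma mnm2_1 i j : mnm2 i j 1%R = j.
Proof. by rewrite mnmDE !mulmnE !mnm1E /= mul0n mul1n. Qed.

Lemma eq_mnm2 i j k l : (mnm2 i j == mnm2 k l) = ((i, j) == (k, l)).
Proof.
apply/eqP/eqP => [e|[-> ->] //].
have := congr1 (fun u : 'X_{1..2} => (u 0%R, u 1%R)) e.
by rewrite /= !mnm2_0 !mnm2_1.
Qed.

Lemma mpolyX2 i j : 'X_0 ^+ i * 'X_1 ^+ j = 'X_[mnm2 i j] :> {mpoly R[i][2]}.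
Proof. by rewrite /mnm2 mpolyXD !mpolyXn. Qed.

Lemma suppE f i j : supp f (i, j) <-> f@_(mnm2 i j) != 0.
Proof. by []. Qed.

Lemma mcoeff_deriv_x f i j :
  (f^`M(0)@_(mnm2 i j) != 0) = (f@_(mnm2 i.+1 j) != 0).
Proof.
have -> : mnm2 i.+1 j = (mnm2 i j + U_(0%R))%MM.
  by rewrite /mnm2 mulmSr -!addmA (addmC (U_(1%R) *+ j)%MM).
by rewrite mcoeff_mderiv mulrn_eq0.
Qed.

Lemma mcoeff_deriv_y f i j :
  (f^`M(1)@_(mnm2 i j) != 0) = (f@_(mnm2 i j.+1) != 0).
Proof.
have -> : mnm2 i j.+1 = (mnm2 i j + U_(1%R))%MM by rewrite /mnm2 mulmSr addmA.
by rewrite mcoeff_mderiv mulrn_eq0.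
Qed.

Lemma supp_deriv f :
  supp f^`M(0) `|` supp f^`M(1) = derived_exponents (supp f).
Proof.
apply/seteqP; split => -[i j] /=.
  case=> /suppE; first by rewrite mcoeff_deriv_x => ?; left; apply/suppE.
  by rewrite mcoeff_deriv_y => ?; right; apply/suppE.
case=> /suppE; first by rewrite -mcoeff_deriv_x => ?; left; apply/suppE.
by rewrite -mcoeff_deriv_y => ?; right; apply/suppE.
Qed.

Lemma exists_nonroot (F : numDomainType) (P : {poly F}) : P != 0 -> exists t, ~~ root P t.
Proof.
move=> P0; apply: contrapT => /forallNP all_root.
have := max_poly_roots (rs := [seq i%:R | i <- iota 0 (size P)]) P0.
rewrite size_map size_iota ltnn => h; suff : false by []; apply: h.
  by apply/allP => x _; apply/negPn/negP/all_root.
by rewrite map_inj_uniq ?iota_uniq // => i j /eqP; rewrite eqr_nat => /eqP.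
Qed.

(** The coefficient of [a g + b h] at [m] vanishes at one point [(a : b)] unless
    it vanishes identically, so the excluded points are the zeros of a finite
    product of linear forms in [(a, b)]. *)
Lemma generic_supp g h :
  exists U : set (R[i] * R[i]),
    [/\ zariski_open_P1 U, U !=set0 &
      forall ab, U ab -> supp (ab.1 *: g + ab.2 *: h) = supp g `|` supp h].
Proof.
pose s := undup (msupp g ++ msupp h).
pose l m : {mpoly R[i][2]} := g@_m *: 'X_0 + h@_m *: 'X_1.
pose H := \prod_(m <- s) l m.
have evall v m : (l m).@[v] = g@_m * v 0 + h@_m * v 1.
  by rewrite /l mevalD !mevalZ !mevalXU.
have evalH ab : H.@[fun k => if k == 0 then ab.1 else ab.2]
  = \prod_(m <- s) (g@_m * ab.1 + h@_m * ab.2).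
  rewrite rmorph_prod; apply: eq_bigr => m _.
  exact: evall.
have sP m : m \in s = (g@_m != 0) || (h@_m != 0).
  by rewrite mem_undup mem_cat !mcoeff_msupp.
exists [set ab | ab <> (0, 0) /\
  exists2 k, [set H] k & k.@[fun k => if k == 0 then ab.1 else ab.2] != 0]; split.
- exists [set H]; split=> // _ ->; rewrite /H.
  elim: s {H evalH sP} => [|m s [d IHs]]; first by exists 0%N; rewrite big_nil dhomog1.
  exists (1 + d)%N; rewrite big_cons dhomogM //.
  by rewrite dhomogD // dhomogZ // dhomogX /= mdeg1.
(* The affine line of points (1, t) already contains a point where the form does not
   vanish. *)
- pose P : {poly R[i]} := \prod_(m <- s) ((g@_m)%:P + h@_m *: 'X).
  have P0 : P != 0.
    rewrite /P prodf_seq_neq0; apply/allP => m; rewrite sP /=.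
    apply: contraL => /eqP /polyP e; move: (e 0%N) (e 1%N).
    rewrite !coefD !coefZ !coefC !coefX /= !mulr0 !mulr1 addr0 add0r => -> ->.
    by rewrite eqxx.
  have [t] := exists_nonroot P0; rewrite /root => Pt.
  exists (1, t); split; first by case=> /eqP; rewrite oner_eq0.
  exists H => //; rewrite evalH /=; move: Pt; rewrite /P horner_prod.
  rewrite (eq_bigr (fun m => g@_m * 1 + h@_m * t)) // => m _.
  by rewrite hornerD hornerC hornerZ hornerX mulr1.
- move=> ab [_ [_ -> ]]; rewrite evalH prodf_seq_neq0 => /allP nz.
  apply/seteqP; split => -[i j]; rewrite /= !suppE mcoeffD !mcoeffZ.
    move=> nz0; apply/orP; move: nz0; apply: contraLR.
    by rewrite negb_or !negbK => /andP[/eqP -> /eqP ->]; rewrite !mulr0 addr0.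
  by move=> /orP; rewrite -sP => /nz /=; rewrite ![ab.1 * _]mulrC ![ab.2 * _]mulrC.
Qed.

Lemma generic_polar_polygon_derived f :
  generic_polar_polygon f (newton_polygon (derived_exponents (supp f))).
Proof.
have [U [oU U0 suppU]] := generic_supp f^`M(0) f^`M(1).
exists U; split=> // ab Uab; congr newton_polygon.
by rewrite /polar suppU // supp_deriv.
Qed.

End Support.

(** * The support of the equation of a branch *)

Lemma mcoeff_branch_eq (R : realType) n m p q (D : set (nat * nat)) (a : nat -> nat -> R[i]) i j :
  (branch_eq n m p q D a)@_(mnm2 i j) =
  ((i, j) == (0%N, n))%:R - ((i, j) == (m, 0%N))%:R + ((i, j) == (p, q))%:R
  + (if [&& i < m, j < n & `[< D (i, j) >]]%N then a i j else 0).
Proof.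
have X0 : 'X_1 ^+ n = 'X_[mnm2 0 n] :> {mpoly R[i][2]} by rewrite -mpolyX2 mul1r.
have X1 : 'X_0 ^+ m = 'X_[mnm2 m 0] :> {mpoly R[i][2]} by rewrite -mpolyX2 mulr1.
rewrite /branch_eq X0 X1 mpolyX2 !mcoeffD mcoeffN !mcoeffX !eq_mnm2.
rewrite ![(_, _) == (i, j)]eq_sym; congr (_ + _).
rewrite raddf_sum /=.
under eq_bigr => k _ do rewrite raddf_sum /=.
have coefE (k : 'I_m) (l : 'I_n) :
  (a k l *: ('X_0 ^+ k * 'X_1 ^+ l))@_(mnm2 i j)
  = a k l *+ ((k == i :> nat) && (l == j :> nat)).
  by rewrite mpolyX2 mcoeffZ mcoeffX eq_mnm2 mulr_natr.
under eq_bigr => k _ do under eq_bigr => l _ do rewrite coefE.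
case: ifP => [/and3P[im jn Dij]|nD].
  rewrite (bigD1 (Ordinal im)) //= (bigD1 (Ordinal jn)) //= !eqxx.
  rewrite !big1 ?addr0 // => [k ki|l /andP[_ lj]].
    by rewrite big1 // => l _; move: ki; rewrite -val_eqE /= => /negPf ->.
  by move: lj; rewrite -val_eqE /= => /negPf ->.
rewrite big1 // => k _; rewrite big1 // => l Dkl.
case: eqP => //= ki; case: eqP => //= lj; case/negP: (negbT nD).
by rewrite -ki -lj !ltn_ord.
Qed.

Section BranchEquation.
Variables (R : realType) (n m p q : nat).
Hypothesis pqP : interior_exponent n m p q.
Variables (D : set (nat * nat)) (a : nat -> nat -> R[i]).
Hypothesis DI : forall i j, D (i, j) -> Ilam n m p q i j.

Local Notation f := (branch_eq n m p q D a).

Let n_lt_m : (n < m)%N. Proof. by case: pqP. Qed.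
Let p_gt0 : (0 < p)%N. Proof. by case: pqP. Qed.
Let p_lt : (p + 1 < m)%N. Proof. by case: pqP. Qed.
Let q_gt0 : (0 < q)%N. Proof. by case: pqP. Qed.
Let q_lt : (q + 1 < n)%N. Proof. by case: pqP. Qed.

Lemma Ilam_neq i j : Ilam n m p q i j ->
  [/\ (i, j) != (0%N, n), (i, j) != (m, 0%N), (i, j) != (p, q), (i < m)%N & (j < n)%N].
Proof.
rewrite /Ilam !xpair_eqE => /and3P[lt im jn]; split; [lia|lia| |lia|lia].
by apply/negP => /andP[/eqP ip /eqP jq]; rewrite ip jq ltnn in lt.
Qed.

Lemma supp_branch_eq_Ilam i j : Ilam n m p q i j ->
  supp f (i, j) <-> D (i, j) /\ a i j != 0.
Proof.
move=> /Ilam_neq[/negPf e1 /negPf e2 /negPf e3 im jn].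
rewrite suppE mcoeff_branch_eq e1 e2 e3 im jn /= subr0 !add0r.
by case: asboolP => [Dij|nD]; [split=> // -[]|rewrite eqxx; split=> // -[]].
Qed.

Lemma supp_branch_eq i j : ~ Ilam n m p q i j ->
  supp f (i, j) <-> [\/ (i, j) = (0%N, n), (i, j) = (m, 0%N) | (i, j) = (p, q)].
Proof.
move=> nI; rewrite suppE mcoeff_branch_eq (asboolF (fun Dij => nI (DI Dij))).
rewrite !andbF addr0.
have [E1|/eqP N1] := eqVneq (i, j) (0%N, n).
  have -> : ((i, j) == (m, 0%N)) = false.
    by apply/negbTE; rewrite E1 xpair_eqE; lia.
  have -> : ((i, j) == (p, q)) = false.
    by apply/negbTE; rewrite E1 xpair_eqE; lia.
  by rewrite subr0 addr0 oner_eq0; split=> // _; apply: Or31.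
have [E2|/eqP N2] := eqVneq (i, j) (m, 0%N).
  have -> : ((i, j) == (p, q)) = false.
    by apply/negbTE; rewrite E2 xpair_eqE; lia.
  by rewrite sub0r addr0 oppr_eq0 oner_eq0; split=> // _; apply: Or32.
rewrite subr0 add0r; have [E3|/eqP N3] := eqVneq (i, j) (p, q).
  by rewrite oner_eq0; split=> // _; apply: Or33.
by rewrite eqxx; split=> // -[].
Qed.

Lemma generic_polar_polygon_branch_eq :
  generic_polar_polygon f (newton_polygon (Elam n m p q `|`
    [set uv | exists i j : nat, [/\ Tlam n m p q i j, supp f (i, j) &
                 uv = (i, j - 1)%N \/ uv = (i - 1, j)%N]])).
Proof.
rewrite -newton_polygon_derived //.
- exact: generic_polar_polygon_derived.
- by apply/supp_branch_eq; [move=> /Ilam_neq[/eqP]|apply: Or31].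
- by apply/supp_branch_eq; [move=> /Ilam_neq[_ /eqP]|apply: Or32].
- by apply/supp_branch_eq; [move=> /Ilam_neq[_ _ /eqP]|apply: Or33].
- move=> i j Fij; have [Iij|/negP nI] := boolP (Ilam n m p q i j); first exact: Or44.
  by case/(supp_branch_eq nI): Fij => ?; [apply: Or41|apply: Or42|apply: Or43].
Qed.

End BranchEquation.

(** The point is above the segment because [n p + m q = (n - 1) m + lambda] and
    [lambda > m]. *)
Lemma is_Phi_interior n m lam p q :
  (2 < n)%N -> (n < m)%N -> (m < lam)%N -> is_Phi n m lam (p, q) ->
  interior_exponent n m p q.
Proof.
move=> n2 nm ltl [alpha [beta [e /andP[a2 an] [b2 blt] [-> ->]]]].
have bm : (beta < m)%N.
  rewrite -(@ltn_pmul2r n); last by lia.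
  by apply: leq_trans blt _; rewrite mulnC leq_mul2l; lia.
split; [exact: nm|lia|lia|lia|lia|].
have := leq_mul (ltnW bm) (leqnn n); have := leq_mul (ltnW a2) (leqnn m).
by rewrite !mulnBl; lia.
Qed.

Theorem theorem4p3 (R : realType) (n m lam p q : nat)
    (a : nat -> nat -> R[i]) (f : {mpoly R[i][2]}) :
  coprime n m -> (2 < n)%N -> (n < m)%N ->
  zariski_exponents n m lam -> is_Phi n m lam (p, q) ->
  f = branch_eq n m p q [set ij | Ilam n m p q ij.1 ij.2] a ->
  [/\ generic_polar_polygon f (newton_polygon
        (Elam n m p q `|`
         [set uv | exists i j : nat,
            [/\ Tlam n m p q i j, supp f (i, j) &
                uv = (i, j - 1)%N \/ uv = (i - 1, j)%N]])),
      (exists N : set (plane R),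
         generic_polar_polygon f N /\
         generic_polar_polygon
           (branch_eq n m p q
              ([set ij | Tlam n m p q ij.1 ij.2] `&` supp f) a) N)
    & ((forall i j : nat, ~ Tlam n m p q i j) ->
       generic_polar_polygon f (newton_polygon (Elam n m p q)))].
Proof.
move=> _ n2 nm [ltl _] /(is_Phi_interior n2 nm ltl) pqP ->.
set D := [set ij | Ilam n m p q ij.1 ij.2]; set f0 := branch_eq n m p q D a.
have D_I i j : D (i, j) -> Ilam n m p q i j by [].
have main := generic_polar_polygon_branch_eq pqP a D_I.
split=> //.
- set D' := _ `&` supp f0.
  have D'_I i j : D' (i, j) -> Ilam n m p q i j.
    by move=> [/= T _]; exact: Tlam_Ilam pqP _ _ T.
  eexists; split; first exact: main.
  have := generic_polar_polygon_branch_eq pqP a D'_I.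
  congr (generic_polar_polygon _ (newton_polygon (_ `|` _))).
  have same_supp i j : Tlam n m p q i j ->
    supp (branch_eq n m p q D' a) (i, j) <-> supp f0 (i, j).
    move=> T; have I := Tlam_Ilam pqP T.
    have [s1 s2] := supp_branch_eq_Ilam pqP D a I.
    have [s3 s4] := supp_branch_eq_Ilam pqP D' a I.
    split=> [/s3[[]] //|s]; apply: s4; split; first by split.
    by have [] := s1 s.
  apply/seteqP; split=> uv [i [j [T s uvE]]]; exists i, j.
    by split=> //; exact/(same_supp _ _ T).
  by split=> //; exact/(same_supp _ _ T).
- move=> T0; move: main; congr (generic_polar_polygon _ (newton_polygon _)).
  apply/seteqP; split=> [uv [//|[i [j [T _ _]]]]|uv]; first by case: (T0 i j).
  by left.
Qed.
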